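(* Let $g>0$, $0<A<1$, $L>0$, and let $\rho_0(x_n)=\operatorname{sign}(x_n)$. Consider all one-dimensional subsolutions whose averaged density $\bar\rho=\bar\rho(x_n,t)$ is the entropy solution of a Riemann problem $$\partial_t\bar\rho+gAt\,\partial_{x_n}\bigl(F(\bar\rho)\bigr)=0,\qquad \bar\rho(\cdot,0)=\rho_0,$$ with $F\in C^2([-1,1])$ uniformly convex and $F(\pm1)=0$. Among all of these, the induced total energy dissipation $E(0)-E(t)$ is maximal for $F=-\frac13 a$, where $a(r)=1-r^2$. Explicitly: for every uniformly convex $F\in C^2([-1,1])$ with $F(\pm1)=0$, the total energy dissipation $E(0)-E(t)$ induced by $F$ is at most the one induced by $F_*(r)=-\frac13(1-r^2)$.
   Context: The setting is the Boussinesq approximation of two incompressible fluids with densities $0<\rho_-<\rho_+$ and Atwood number $A=\frac{\rho_+-\rho_-}{\rho_++\rho_-}$, under gravity $g$, in the periodic channel $\mathbb T^{n-1}\times(-L,L)$, $n\in\{2,3\}$, with $x_n\in(-L,L)$ the vertical coordinate; the initial state is at rest, with the heavier fluid on top (normalized density $\rho_0=\operatorname{sign}(x_n)$). A one-dimensional subsolution is a horizontally averaged profile, with averaged velocity $v\equiv0$ and averaged momentum flux $m=gAt\,F(\bar\rho)\,e_n$, so that the density $\bar\rho$ solves the stated conservation law; it is determined by the flux function $F$. The total energy dissipation $E(0)-E(t)$ at time $t>0$ induced by such a subsolution is $E(0)-E(t)=c\,J(F)$, where $c>0$ is a constant depending only on $t$, $g$, $\rho_\pm$ (not on $F$) and $$J(F)=\int_{-1}^1\left[\frac{d}{dr}\left(\frac{F(r)^2}{a(r)}\right)F'(r)+\frac12\bigl(F'(r)\bigr)^2\right]dr,\qquad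 a(r)=1-r^2 .$$ Here $F^2/a$ is extended by $0$ at $r=\pm1$. ''Uniformly convex'' means $F''\ge\delta$ on $[-1,1]$ for some $\delta>0$. *)

(* Defs.v *)
From HB Require Import structures.
From mathcomp Require Import all_boot all_order all_algebra.
From mathcomp Require Import all_classical all_reals all_analysis.

Set Implicit Arguments.
Unset Strict Implicit.
Unset Printing Implicit Defensive.

Import Order.TTheory GRing.Theory Num.Theory.
Import numFieldNormedType.Exports.

Local Open Scope classical_set_scope.
Local Open Scope ring_scope.

Definition atwood (R : realType) (rm rp : R) : R := (rp - rm) / (rp + rm).

Definition acoef (R : realType) (r : R) : R := 1 - r ^+ 2.

(* [f'] is the derivative of [f] relative to [D]: on a closed interval this is
   the one-sided derivative at the endpoints, so values of [f] outside [D] play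
   no role. *)
Definition derivative_on (R : realType) (D : set R) (f f' : R -> R) : Prop :=
  forall x, D x -> (f y - f x) / (y - x) @[y --> within D x^'] --> f' x.

Definition C2_on (R : realType) (D : set R) (f f1 f2 : R -> R) : Prop :=
  [/\ derivative_on D f f1, derivative_on D f1 f2 & {within D, continuous f2}].

Definition uniformly_convex_C2 (R : realType) (F : R -> R) : Prop :=
  exists F1 F2 : R -> R, C2_on `[-1, 1] F F1 F2 /\
    exists2 d : R, 0 < d & forall r, -1 <= r <= 1 -> d <= F2 r.

Definition admissible_flux (R : realType) (F : R -> R) : Prop :=
  [/\ uniformly_convex_C2 F, F (-1) = 0 & F 1 = 0].

Definition Fstar (R : realType) (r : R) : R := - (3%:R)^-1 * acoef r.

Definition sq_over_a (R : realType) (F : R -> R) (r : R) : R :=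
  if `|r| < 1 then F r ^+ 2 / acoef r else 0.

(* Only the derivatives on the open interval ]-1, 1[ matter here, the endpoints
   being Lebesgue-negligible; for an admissible flux the integrand is continuous
   and bounded on ]-1, 1[. *)
Definition Jfun (R : realType) (F : R -> R) : R :=
  \int[lebesgue_measure]_(r in `[-1, 1])
    (derive1 (sq_over_a F) r * derive1 F r + 2%:R^-1 * derive1 F r ^+ 2).

(* E(0) - E(t) = c J(F), where [c] is a function of t, g, rho_-, rho_+ only. *)
Definition energy_dissipation (R : realType) (c : R -> R -> R -> R -> R)
    (t g rm rp : R) (F : R -> R) : R :=
  c t g rm rp * Jfun F.

(* Nonnegative C^1 functions on R x R with compact support, with their partial
   derivatives in x (first variable) and t (second variable).  They need not
   vanish at t = 0. *)
Definition test_function (R : realType) (phi phix phit : R -> R -> R) : Prop :=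
  [/\ forall x t, 0 <= phi x t,
      forall x t, is_derive x (1 : R) (phi^~ t) (phix x t)
               /\ is_derive t (1 : R) (phi x) (phit x t),
      continuous (fun p : R * R => phix p.1 p.2),
      continuous (fun p : R * R => phit p.1 p.2) &
      exists M : R, forall x t, (M < `|x|) || (M < `|t|) -> phi x t = 0].

(* Kruzhkov entropy solutions, on R x [0, +oo[ and with values in [-1, 1] (where
   the flux is defined), of
     d_t rho + g A t d_x (F rho) = 0,   rho(., 0) = sign.
   As rho takes values in [-1, 1], the entropies |. - k| with k in [-1, 1]
   suffice: k = 1 and k = -1 already give the weak formulation, to which the
   inequalities with |k| > 1 reduce. *)
Definition entropy_solution (R : realType) (g A : R) (F : R -> R)
    (rho : R -> R -> R) : Prop :=
  [/\ measurable_fun [set p : R * R | 0 <= p.2] (fun p => rho p.1 p.2),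
      forall x t, 0 <= t -> -1 <= rho x t <= 1 &
      forall (k : R) (phi phix phit : R -> R -> R),
        -1 <= k <= 1 -> test_function phi phix phit ->
        0 <= \int[(@lebesgue_measure R \x @lebesgue_measure R)%E]_(p in
                   [set p : R * R | 0 <= p.2])
               (`|rho p.1 p.2 - k| * phit p.1 p.2
                + g * A * p.2 * Num.sg (rho p.1 p.2 - k)
                  * (F (rho p.1 p.2) - F k) * phix p.1 p.2)
             + \int[lebesgue_measure]_x (`|Num.sg x - k| * phi x 0)].

Definition e_last (R : realType) (n : nat) : 'rV[R]_n :=
  \row_(j < n) ((j.+1 == n)%:R).

(* The averaged quantities depend on the position in T^{n-1} x ]-L, L[ only
   through the vertical coordinate x.  The Riemann problem is posed on the whole
   line, and the profile in the channel is the restriction of its solution. *)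
Record subsolution1d (R : realType) (n : nat) (g A L : R) := Subsolution1d {
  flux : R -> R;
  density : R -> R -> R;
  velocity : R -> R -> 'rV[R]_n;
  momentum : R -> R -> 'rV[R]_n;
  flux_admissible : admissible_flux flux;
  density_entropy : entropy_solution g A flux density;
  velocity0 : forall x t, - L < x < L -> 0 <= t -> velocity x t = 0;
  momentumE : forall x t, - L < x < L -> 0 <= t ->
    momentum x t = (g * A * t * flux (density x t)) *: e_last R n }.

(* Main.v *)
(** With [p = F / a], integrating by parts (the boundary terms vanish, as [F] and
    [a] do) gives [J F = - \int (p F + F / 2) F''].  Since [F'' >= 0], completing
    the square in [p] at [-1/3] bounds the integrand by
    [(a / 9 + F / 6) F''], and a second integration by parts followed by completing
    the square in [F'] at [2 r / 3] gives [J F <= \int 2 r^2 / 27].  Both squares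
    vanish for [F = - a / 3].  The two steps are merged into the pointwise identity
    [G' + 2 r^2 / 27 - j = a F'' (p + 1/3)^2 + (F' - 2 r / 3)^2 / 6], where [j] is
    the integrand of [J] and [G = p F F' + F F' / 2 + (a / 9 + F / 6) F'] vanishes
    at both endpoints. *)

Require Import Defs.
From HB Require Import structures.
From mathcomp Require Import all_boot all_order all_algebra.
From mathcomp Require Import all_classical all_reals all_analysis.
From mathcomp Require Import measurable_realfun ring lra.
Import Order.TTheory GRing.Theory Num.Theory.
Import numFieldNormedType.Exports.
Local Open Scope classical_set_scope.
Local Open Scope ring_scope.

Set Implicit Arguments.
Unset Strict Implicit.
Unset Printing Implicit Defensive.

(** * Difference quotients and derivatives relative to a set *)

(** Carathéodory's factor: the value [f' x] on the diagonal lets limits be taken along full rather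
    than punctured neighbourhoods. *)
Definition slope (R : realType) (f f' : R -> R) (x y : R) : R :=
  if y == x then f' x else (f y - f x) / (y - x).

Lemma slopeE (R : realType) (f f' : R -> R) (x y : R) :
  f y = f x + slope f f' x y * (y - x).
Proof.
rewrite /slope; case: eqVneq => [->|yx]; first by rewrite subrr mulr0 addr0.
by rewrite mulfVK ?subr_eq0// addrC subrK.
Qed.

Lemma derivative_on_slope (R : realType) (D : set R) (f f' : R -> R) (x : R) :
  derivative_on D f f' -> D x ->
  slope f f' x y @[y --> within D (nbhs x)] --> f' x.
Proof.
move=> df Dx; apply/cvgrPdist_lt => e e0.
have /cvgrPdist_lt/(_ e e0) := df x Dx.
rewrite !near_withinE => /=.
apply: filterS => y h Dy; rewrite /slope.
case: (eqVneq y x) => [_|yx]; first by rewrite subrr normr0.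
exact: h.
Qed.

Lemma derivative_on_continuous (R : realType) (D : set R) (f f' : R -> R) :
  derivative_on D f f' -> {within D, continuous f}.
Proof.
move=> df; apply/subspace_continuousP => x Dx.
suff : f x + slope f f' x y * (y - x) @[y --> within D (nbhs x)]
    --> f x + f' x * (x - x).
  by under eq_fun do rewrite -slopeE; rewrite subrr mulr0 addr0.
apply: cvgD; first exact: cvg_cst.
apply: cvgM; first exact: derivative_on_slope.
by apply: cvgB; [apply: cvg_within_filter; exact: cvg_id|exact: cvg_cst].
Qed.

(** Carathéodory's criterion with factor [slope f f' x]: when [D] is a neighbourhood of [x], the
    restriction to [D] disappears from the limit. *)
Lemma derivative_on_is_derive (R : realType) (D : set R) (f f' : R -> R) (x : R) :
  derivative_on D f f' -> nbhs x D -> is_derive x 1 f (f' x).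
Proof.
move=> df Dx; apply/is_derive1_caratheodory; exists (slope f f' x).
have E : slope f f' x x = f' x by rewrite /slope eqxx.
split=> // [z|]; first by rewrite (slopeE f f' x z) addrC addKr.
rewrite /prop_for /continuous_at E; apply/cvgrPdist_lt => e e0.
have /cvgrPdist_lt/(_ e e0) := derivative_on_slope df (nbhs_singleton Dx).
rewrite near_withinE => h; near=> y.
by have : D y -> `|f' x - slope f f' x y| < e; [near: y|apply; near: y].
Unshelve. all: by end_near. Qed.

Lemma is_derive_derivative_on (R : realType) (D : set R) (f f' : R -> R) :
  (forall x, D x -> is_derive x 1 f (f' x)) -> derivative_on D f f'.
Proof.
move=> df x Dx.
have /is_derive1_caratheodory[g [fg cg gx]] := df x Dx.
apply: (@cvg_trans _ (g y @[y --> within D x^'])); last first.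
  by apply: cvg_within_filter; rewrite -gx; apply: cvg_within_filter; exact: cg.
apply: near_eq_cvg; rewrite near_withinE near_withinE; near=> y => yx _.
by rewrite fg mulfK// subr_eq0.
Unshelve. all: by end_near. Qed.

(** * The quotient [F / a] up to the endpoints, and derivatives on the open interval *)

(* [F / a], with the endpoint values given by L'Hopital's rule. *)
Definition quot_a (R : realType) (F F1 : R -> R) (r : R) : R :=
  if `|r| < 1 then F r / acoef r else - r * F1 r / 2.

Lemma acoef_neq0 (R : realType) (r : R) : `|r| < 1 -> acoef r != 0.
Proof. by rewrite ltr_norml /acoef => /andP[? ?]; apply/negP => /eqP; nra. Qed.

Lemma acoef_ge0 (R : realType) (r : R) : -1 <= r <= 1 -> 0 <= acoef r.
Proof. by rewrite /acoef => /andP[? ?]; nra. Qed.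

Lemma itv_cc11_cases (R : realType) (r : R) :
  `[-1, 1]%classic r -> `|r| < 1 \/ r = 1 \/ r = -1.
Proof.
rewrite /= in_itv /= ltr_norml => /andP[].
rewrite !le_eqVlt => /predU1P[<- _|->]; first by right; right.
by case/predU1P => [->|->]; [right; left|left].
Qed.

(** At the endpoints both sides vanish, so this division-free form of [p = F / a] holds on the whole
    segment. *)
Lemma acoef_quot (R : realType) (F F1 : R -> R) (r : R) :
  F (-1) = 0 -> F 1 = 0 -> -1 <= r <= 1 -> acoef r * quot_a F F1 r = F r.
Proof.
move=> Fm Fp r1; have [rlt|] := @itv_cc11_cases _ r r1.
  by rewrite /quot_a rlt mulrC divfK// acoef_neq0.
by rewrite /acoef => -[->|->]; rewrite ?Fm ?Fp ?sqrrN expr1n subrr mul0r.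
Qed.

Lemma acoef_continuous (R : realType) : continuous (@acoef R).
Proof.
by move=> x; apply: cvgB; [exact: cvg_cst|exact: exprn_continuous].
Qed.

Lemma near_norm_lt1 (R : realType) (x : R) :
  `|x| < 1 -> \forall y \near x, `|y| < 1.
Proof. by move=> x1; apply: (@cvgr_norm_lt _ _ _ (nbhs x) _ id x cvg_id). Qed.

(** Since [e ^+ 2 = 1], [acoef y] factors as [(e - y) * (e + y)]. With [F e = 0] this makes
    [F y / acoef y] the slope of [F] at [e] times [- (y + e)^-1], and both factors converge. *)
Lemma quot_a_endpoint (R : realType) (F F1 : R -> R) (e : R) :
  derivative_on `[-1, 1] F F1 -> e = 1 \/ e = -1 -> F e = 0 ->
  quot_a F F1 @ within `[-1, 1] (nbhs e) --> quot_a F F1 e.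
Proof.
move=> dF e1 Fe.
have e2 : e ^+ 2 = 1 by case: e1 => ->; rewrite ?sqrrN expr1n.
have e0 : e != 0 by case: e1 => ->; rewrite ?oppr_eq0 oner_eq0.
have ne1 : `|e| = 1 by case: e1 => ->; rewrite ?normrN normr1.
have Ie : `[-1, 1]%classic e by rewrite /= in_itv /= -ler_norml ne1.
have qe : quot_a F F1 e = F1 e * - (e + e)^-1.
  by rewrite /quot_a ne1 ltxx; case: (e1) => ->; field.
suff h : slope F F1 e y * - (y + e)^-1 @[y --> within `[-1, 1]%classic (nbhs e)]
    --> quot_a F F1 e.
  apply: cvg_trans h; apply: near_eq_cvg; rewrite near_withinE.
  have ye : \forall y \near e, y + e != 0.
    apply: (@cvgr_neq0 _ _ _ (nbhs e) _ (fun y => y + e) (e + e)).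
      by apply: cvgD; [exact: cvg_id|exact: cvg_cst].
    by rewrite -mulr2n mulrn_eq0.
  near=> y => Iy.
  have yNe : y + e != 0 by near: y.
  rewrite /slope; case: (eqVneq y e) => [->//|yne].
  (* [y != e] and [y + e != 0] exclude both endpoints. *)
  have y1 : `|y| < 1.
    by case: (itv_cc11_cases Iy) yNe yne => // -[] ->; case: (e1) => ->;
      rewrite ?eqxx ?subrr ?addNr ?eqxx.
  rewrite /quot_a y1 Fe subr0 mulrN -mulrA -invfM -mulrN -invrN; congr (_ * _^-1).
  by rewrite /acoef -e2; ring.
rewrite qe; apply: cvgM; first exact: derivative_on_slope.
apply: cvgN; apply: cvgV; first by rewrite -mulr2n mulrn_eq0.
by apply: cvgD; [apply: cvg_within_filter; exact: cvg_id|exact: cvg_cst].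
Unshelve. all: by end_near. Qed.

Lemma quot_a_continuous (R : realType) (F F1 : R -> R) :
  derivative_on `[-1, 1] F F1 -> F (-1) = 0 -> F 1 = 0 ->
  {within `[-1, 1], continuous (quot_a F F1)}.
Proof.
move=> dF Fm Fp; apply/subspace_continuousP => x Ix.
have [x1|] := itv_cc11_cases Ix; last first.
  by move=> xe; apply: quot_a_endpoint => //; case: xe => ->.
suff h : F y / acoef y @[y --> within `[-1, 1]%classic (nbhs x)]
    --> quot_a F F1 x.
  apply: cvg_trans h; apply: near_eq_cvg; apply: cvg_within.
  near=> y; have y1 : `|y| < 1 by near: y; exact: near_norm_lt1.
  by rewrite /from_subspace /quot_a y1.
rewrite /quot_a x1; apply: cvgM.
  by have /subspace_continuousP := derivative_on_continuous dF; exact.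
apply: cvgV; first exact: acoef_neq0.
by apply: cvg_within_filter; exact: acoef_continuous.
Unshelve. all: by end_near. Qed.

Lemma derivative_on_itv_oo (R : realType) (F F1 : R -> R) (x : R) :
  derivative_on `[-1, 1] F F1 -> `|x| < 1 -> is_derive x 1 F (F1 x).
Proof.
move=> dF x1; apply: (derivative_on_is_derive dF).
have := near_norm_lt1 x1; apply: filterS => y.
by rewrite /= in_itv /= -ler_norml => /ltW.
Qed.

Lemma is_derive_acoef (R : realType) (x : R) :
  is_derive x 1 (@acoef R) (- 2 * x).
Proof.
have -> : @acoef R = cst 1 - (@idfun R) ^+ 2 by [].
by apply: is_derive_eq; rewrite /GRing.scale/=; ring.
Qed.

Lemma near_quot_a (R : realType) (F F1 : R -> R) (x : R) :
  `|x| < 1 -> \forall y \near x, quot_a F F1 y = F y / acoef y.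
Proof.
by move=> /near_norm_lt1; apply: filterS => y y1; rewrite /quot_a y1.
Qed.

Lemma near_sq_over_a (R : realType) (F : R -> R) (x : R) :
  `|x| < 1 -> \forall y \near x, sq_over_a F y = F y ^+ 2 / acoef y.
Proof.
by move=> /near_norm_lt1; apply: filterS => y y1; rewrite /sq_over_a y1.
Qed.

Lemma is_derive_div_acoef (R : realType) (F : R -> R) (x d : R) :
  `|x| < 1 -> is_derive x 1 F d ->
  is_derive x 1 (fun y => F y / acoef y)
    (d / acoef x + 2 * x * F x / acoef x ^+ 2).
Proof.
move=> x1 dF; have a0 := acoef_neq0 x1.
have da := is_derive_acoef x.
have dV := is_deriveV a0 da.
rewrite (_ : (fun _ => _) = F * (fun y => (acoef y)^-1)) //.
by apply: is_derive_eq; rewrite /GRing.scale/=; field.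
Qed.

(** Written through [p = F / a], the derivative has no denominator left, hence extends continuously
    to the endpoints. *)
Lemma derive1_sq_over_a (R : realType) (F F1 : R -> R) (x : R) :
  derivative_on `[-1, 1] F F1 -> `|x| < 1 ->
  derive1 (sq_over_a F) x = 2 * quot_a F F1 x * F1 x + 2 * x * quot_a F F1 x ^+ 2.
Proof.
move=> dF x1; have := derivative_on_itv_oo dF x1 => dFx.
have a0 := acoef_neq0 x1.
have d2 : is_derive x 1 (fun y => F y ^+ 2) (2 * F x * F1 x).
  rewrite (_ : (fun _ => _) = F ^+ 2) //.
  by apply: is_derive_eq; rewrite expr1 /GRing.scale/=; ring.
have d := is_derive_div_acoef x1 d2.
rewrite derive1E (near_eq_derive _ (near_sq_over_a F x1)) derive_val.
by rewrite /quot_a x1; field.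
Qed.

(** * Integrals over a segment *)

(** The endpoints are negligible; continuity of [g] gives measurability of both functions on the
    open interval. *)
Lemma eq_Rintegral_itv_oo (R : realType) (a b : R) (f g : R -> R) :
  {within `[a, b], continuous g} -> {in `]a, b[, f =1 g} ->
  \int[lebesgue_measure]_(x in `[a, b]) f x =
  \int[lebesgue_measure]_(x in `[a, b]) g x.
Proof.
move=> cg fg.
have mg : measurable_fun `]a, b[ g.
  apply: (@measurable_funS _ _ _ _ `[a, b]) => //.
    by apply: subset_itv_oo_cc.
  exact: subspace_continuous_measurable_fun.
have mf : measurable_fun `]a, b[ f.
  apply: eq_measurable_fun mg => x; rewrite inE => /= xab.
  by rewrite fg.
rewrite /Rintegral (@integral_itv_bndoo _ _ _ (EFin \o f)); last first.
  exact/measurable_EFinP.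
rewrite (@integral_itv_bndoo _ _ _ (EFin \o g)); last exact/measurable_EFinP.
by congr fine; apply: eq_integral => x; rewrite inE => /= xab; rewrite fg.
Qed.

Lemma integrable_continuous_itv (R : realType) (a b : R) (f : R -> R) :
  {within `[a, b], continuous f} ->
  (@lebesgue_measure R).-integrable `[a, b] (EFin \o f).
Proof.
by move=> cf; apply: continuous_compact_integrable => //; exact: segment_compact.
Qed.

Lemma Rintegral_derivative_eq0 (R : realType) (a b : R) (G g : R -> R) :
  a < b -> {within `[a, b], continuous G} -> {within `[a, b], continuous g} ->
  (forall x, a < x < b -> is_derive x 1 G (g x)) -> G a = G b ->
  \int[lebesgue_measure]_(x in `[a, b]) g x = 0.
Proof.
move=> ab cG cg dG Gab.
have [_ Ga Gb] := (continuous_within_itvP _ ab).1 cG.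
rewrite /Rintegral (@continuous_FTC2 _ g G) //.
- by rewrite -EFinB Gab subrr.
- split=> // x; rewrite in_itv /= => /dG dx.
  exact: ex_derive.
- by move=> x; rewrite in_itv /= => /dG dx; rewrite derive1E derive_val.
Qed.

Lemma within_continuousM (R : realType) (A : set R) (f g : R -> R) :
  {within A, continuous f} -> {within A, continuous g} ->
  {within A, continuous (f * g)}.
Proof. by move=> cf cg x; apply: cvgM; [exact: cf|exact: cg]. Qed.

Lemma within_continuous_cst (R : realType) (A : set R) (k : R) :
  {within A, continuous (fun=> k)}.
Proof. by move=> x; exact: cvg_cst. Qed.

(** Splits sums, products and squares syntactically; the atoms are closed by continuity facts in the
    context. *)
Ltac within_continuity :=
  lazymatch goal with
  | |- continuous (from_subspace ?A (fun r => @?f r + @?g r)) =>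
    apply: (@within_continuousD _ _ _ A f g); within_continuity
  | |- continuous (from_subspace ?A (fun r => @?f r * @?g r)) =>
    apply: (@within_continuousM _ A f g); within_continuity
  | |- continuous (from_subspace ?A (fun r => @?f r ^+ 2)) =>
    apply: (@within_continuousM _ A f f); within_continuity
  | |- continuous (from_subspace ?A (fun=> ?k)) =>
    exact: within_continuous_cst
  | |- _ => assumption
  end.

(** * The upper bound for [Jfun] *)

Section upper_bound.
Variables (R : realType) (F F1 F2 : R -> R).
Hypothesis F_C2 : C2_on `[-1, 1] F F1 F2.
Hypotheses (Fm : F (-1) = 0) (Fp : F 1 = 0).

Let p := quot_a F F1.

(** The integrand of [Jfun] in terms of [p], continuous on the closed segment. *)
Let J1 (r : R) := (2 * p r * F1 r + 2 * r * p r ^+ 2) * F1 r + 2%:R^-1 * F1 r ^+ 2.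

Let dF : derivative_on `[-1, 1] F F1. Proof. by case: F_C2. Qed.
Let dF1 : derivative_on `[-1, 1] F1 F2. Proof. by case: F_C2. Qed.
Let cF : {within `[-1, 1], continuous F}.
Proof. exact: derivative_on_continuous dF. Qed.
Let cF1 : {within `[-1, 1], continuous F1}.
Proof. exact: derivative_on_continuous dF1. Qed.
Let cF2 : {within `[-1, 1], continuous F2}. Proof. by case: F_C2. Qed.
Let cp : {within `[-1, 1], continuous p}.
Proof. exact: quot_a_continuous dF Fm Fp. Qed.

Let cid : {within `[-1, 1], continuous (@id R)}.
Proof. by apply: continuous_subspaceT => x; exact: cvg_id. Qed.

Let G (r : R) := p r * F r * F1 r + 2^-1 * F r * F1 r
  + (9^-1 * acoef r + 6^-1 * F r) * F1 r.

(** The derivative of [G], with [p'] eliminated: on the open interval [p' = (F1 + 2 r p) / a], so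
    [p' F F1 = (F1 + 2 r p) p F1]. No division by [a] remains, and the first term is that of
    [J1]. *)
Let G1 (r : R) := (2 * p r * F1 r + 2 * r * p r ^+ 2) * F1 r + p r * F r * F2 r
  + 2^-1 * (F1 r ^+ 2 + F r * F2 r)
  + (- (2 / 9) * r + 6^-1 * F1 r) * F1 r + (9^-1 * acoef r + 6^-1 * F r) * F2 r.

Let ca : {within `[-1, 1], continuous (@acoef R)}.
Proof. by apply: continuous_subspaceT; exact: acoef_continuous. Qed.

Let cJ1 : {within `[-1, 1], continuous J1}.
Proof. rewrite /J1; within_continuity. Qed.

Let cG : {within `[-1, 1], continuous G}.
Proof. rewrite /G; within_continuity. Qed.

Let cG1 : {within `[-1, 1], continuous G1}.
Proof. rewrite /G1; within_continuity. Qed.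

Let dG (x : R) : -1 < x < 1 -> is_derive x 1 G (G1 x).
Proof.
rewrite -ltr_norml => x1.
have dFx := derivative_on_itv_oo dF x1.
have dF1x := derivative_on_itv_oo dF1 x1.
have dax := is_derive_acoef x.
have a0 := acoef_neq0 x1.
(* Near an interior point [p] is the plain quotient [F / a]. *)
have dpx : is_derive x 1 p (F1 x / acoef x + 2 * x * F x / acoef x ^+ 2).
  apply: near_eq_is_derive (is_derive_div_acoef x1 dFx).
  by move: (near_quot_a F F1 x1); apply: filterS => y.
have -> : G = p * F * F1 + (2^-1 \*: F) * F1
  + (9^-1 \*: (@acoef R) + 6^-1 \*: F) * F1 by [].
apply: (is_derive_eq (is_deriveD
  (is_deriveD (is_deriveM (is_deriveM dpx dFx) dF1x)
              (is_deriveM (is_deriveZ _ dFx) dF1x))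
  (is_deriveM (is_deriveD (is_deriveZ _ dax) (is_deriveZ _ dFx)) dF1x))).
rewrite /G1 !fctE /GRing.scale/= /GRing.scale/=.
by rewrite /p /quot_a x1; field.
Qed.

Lemma Jfun_C2 : Jfun F = \int[lebesgue_measure]_(r in `[-1, 1]) J1 r.
Proof.
rewrite /Jfun; apply: eq_Rintegral_itv_oo => // x.
rewrite in_itv /= -ltr_norml => x1.
have dFx := derivative_on_itv_oo dF x1.
by rewrite (derive1_sq_over_a dF x1) derive1E derive_val.
Qed.

Lemma Jfun_le : (forall r, -1 <= r <= 1 -> 0 <= F2 r) ->
  Jfun F <= \int[lebesgue_measure]_(r in `[-1, 1]) (2 / 27 * r ^+ 2).
Proof.
move=> F2ge0.
have cw : {within `[-1, 1], continuous (fun r : R => 2 / 27 * r ^+ 2)}.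
  by within_continuity.
have G0 : G (-1) = G 1.
  by rewrite /G Fm Fp /acoef sqrrN expr1n subrr; ring.
rewrite Jfun_C2 -[leRHS]add0r.
(* The added 0 becomes the integral of [G1], which reduces the claim to the pointwise bound
   [J1 r <= G1 r + 2 / 27 * r ^+ 2]. *)
rewrite -(Rintegral_derivative_eq0 _ cG cG1 dG G0); last by lra.
rewrite -RintegralD//; [|exact: integrable_continuous_itv..].
apply: le_Rintegral => //.
- exact: integrable_continuous_itv.
- by apply: integrable_continuous_itv => x; apply: cvgD; [exact: cG1|exact: cw].
move=> r; rewrite /= in_itv /= => r1.
have Fr := acoef_quot F1 Fm Fp r1; rewrite -/p in Fr.
have a0 := acoef_ge0 r1; have h0 := F2ge0 r r1.
rewrite -subr_ge0.
have -> : G1 r + 2 / 27 * r ^+ 2 - J1 r =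
  acoef r * F2 r * (p r + 3^-1) ^+ 2 + 6^-1 * (F1 r - 2 / 3 * r) ^+ 2.
  (* Replacing [F r] by [acoef r * p r] makes this a polynomial identity, valid at the endpoints
     too. *)
  by rewrite /G1 /J1 -Fr; field.
by apply: addr_ge0; apply: mulr_ge0; rewrite ?sqr_ge0 ?mulr_ge0// invr_ge0.
Qed.

End upper_bound.

(** * The value at [Fstar] and the comparison *)

(** Agreement with [Fstar] on the segment suffices because [derivative_on] sees only values there;
    this covers a subsolution whose flux is arbitrary outside it. *)
Lemma eq_Fstar_C2_on (R : realType) (F : R -> R) :
  (forall r, -1 <= r <= 1 -> F r = Fstar r) ->
  C2_on `[-1, 1] F (fun r => 2 / 3 * r) (fun=> 2 / 3).
Proof.
move=> FE; split; last exact: within_continuous_cst.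
- have dFs : derivative_on `[-1, 1] (@Fstar R) (fun r => 2 / 3 * r).
    apply: is_derive_derivative_on => x _.
    have dax := is_derive_acoef x.
    apply: (is_derive_eq (is_deriveZ (- 3^-1) dax)).
    by rewrite /GRing.scale/=; field.
  move=> x Ix; apply: cvg_trans (dFs x Ix); apply: near_eq_cvg.
  rewrite near_withinE; near=> y => Iy.
  by rewrite !FE.
- apply: is_derive_derivative_on => x _.
  apply: (is_derive_eq (is_deriveZ (2 / 3) (is_derive_id x (1 : R)))).
  by rewrite /GRing.scale/= mulr1.
Unshelve. all: by end_near. Qed.

Lemma Fstar_endpoints (R : realType) : Fstar (-1 : R) = 0 /\ Fstar (1 : R) = 0.
Proof. by rewrite /Fstar /acoef sqrrN expr1n subrr mulr0. Qed.

Lemma Jfun_eq_Fstar (R : realType) (F : R -> R) :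
  (forall r, -1 <= r <= 1 -> F r = Fstar r) ->
  Jfun F = \int[lebesgue_measure]_(r in `[-1, 1]) (2 / 27 * r ^+ 2).
Proof.
move=> FE; have [Fm Fp] := Fstar_endpoints R.
rewrite (Jfun_C2 (eq_Fstar_C2_on FE)).
- apply: eq_Rintegral_itv_oo => [|x].
    have cid : {within `[-1, 1], continuous (@id R)}.
      by apply: continuous_subspaceT => x; exact: cvg_id.
    by within_continuity.
  rewrite in_itv /= -ltr_norml => x1.
  rewrite /quot_a x1 FE; last by rewrite -ler_norml ltW.
  (* Here [p = - 1 / 3] and [F' = 2 r / 3], so the integrand is
     [- 4 r^2 / 27 + 2 r^2 / 9 = 2 r^2 / 27]. *)
  by rewrite /Fstar; have := acoef_neq0 x1; move=> ?; field.
- by rewrite FE //; lra.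
- by rewrite FE //; lra.
Qed.

Lemma admissible_Fstar (R : realType) : admissible_flux (@Fstar R).
Proof.
have [Fm Fp] := Fstar_endpoints R; split=> //.
exists (fun r => 2 / 3 * r), (fun=> 2 / 3); split; first exact: eq_Fstar_C2_on.
by exists (2 / 3) => //; lra.
Qed.

Lemma Jfun_le_Fstar (R : realType) (F Fs : R -> R) :
  admissible_flux F -> (forall r, -1 <= r <= 1 -> Fs r = Fstar r) ->
  Jfun F <= Jfun Fs.
Proof.
move=> [[F1 [F2 [F_C2 [d d0 dF2]]]] Fm Fp] FsE.
rewrite (Jfun_eq_Fstar FsE); apply: (Jfun_le F_C2) => // r /dF2.
by apply: le_trans; exact: ltW.
Qed.

Theorem corollary1p2 (R : realType) (n : nat) (g rm rp L : R)
    (c : R -> R -> R -> R -> R)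
    (hn : n = 2%N \/ n = 3%N) (hg : 0 < g) (hrm : 0 < rm) (hrp : rm < rp)
    (hL : 0 < L)
    (hc : forall t, 0 < t -> 0 < c t g rm rp) :
  [/\ admissible_flux (@Fstar R),
      forall F : R -> R, admissible_flux F ->
        forall t, 0 < t ->
          energy_dissipation c t g rm rp F
            <= energy_dissipation c t g rm rp (@Fstar R)
    & forall S Sstar : subsolution1d n g (atwood rm rp) L,
        (forall r, -1 <= r <= 1 -> flux Sstar r = Fstar r) ->
        forall t, 0 < t ->
          energy_dissipation c t g rm rp (flux S)
            <= energy_dissipation c t g rm rp (flux Sstar)].
Proof.
split; first exact: admissible_Fstar.
(* Both dissipations carry the same positive factor [c t g rm rp], so comparing [Jfun] is enough. *)
- move=> F aF t t0; apply: (ler_wpM2l (ltW (hc t t0))).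
  by apply: (Jfun_le_Fstar aF).
- move=> S Ss SsE t t0; apply: (ler_wpM2l (ltW (hc t t0))).
  exact: (Jfun_le_Fstar (flux_admissible S) SsE).
Qed.
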